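(* Let $\mathcal{M}=(0,1)^{n}$, let $T>0$, and let $f:\mathbb{R}^{n}\to\mathbb{R}$ be continuously differentiable (without loss of generality, non-negative on $[0,1]^{n}$). Let the activation function $\boldsymbol{\sigma}:\mathbb{R}^{n}\to(0,1)^{n}$ be a homeomorphism that is differentiable almost everywhere and has the structure $\boldsymbol{\sigma}(\boldsymbol{y})=(\sigma_{1}(y_{1}),\ldots,\sigma_{n}(y_{n}))^{\top}$ with each $\sigma_{i}$ strictly increasing. Let $\boldsymbol{G}(\boldsymbol{x})$ be the diagonal metric tensor on $\mathcal{M}$ with diagonal entries $g_{ii}(x_i)=1/\sigma_i'(\sigma_i^{-1}(x_i))$, and write $g^{ii}=1/g_{ii}$ for the diagonal entries of $\boldsymbol{G}^{-1}$. Consider the stochastic Hopfield neural network (the ''diffusion machine''), i.e. the Itô stochastic differential equation with state $\boldsymbol{x}\in(0,1)^n$ $$\mathrm{d}x_i=\Big\{-g^{ii}(x_i)\frac{\partial f}{\partial x_i}+T\frac{\partial g^{ii}}{\partial x_i}\Big\}\,\mathrm{d}t+\sqrt{2T\,g^{ii}(x_i)}\;\mathrm{d}w_i,\qquad i=1,\ldots,n,$$ where $\boldsymbol{w}$ is the standard Wiener process in $\mathbb{R}^n$. The associated Fokker-Planck-Kolmogorov equation governing the evolution of the joint probability density $\rho(\boldsymbol{x},t)$, with initial condition $\rho(\boldsymbol{x},0)=\rho_0(\boldsymbol{x})$, $\rho_0\in\mathcal{P}_2(\mathcal{M})$, is $$\frac{\partial\rho}{\partial t}=\sum_{i=1}^{n}\frac{\partial}{\partial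 x_i}\Big\{\rho\Big(g^{ii}\frac{\partial f}{\partial x_i}-T\frac{\partial g^{ii}}{\partial x_i}\Big)+\frac12\frac{\partial}{\partial x_i}\big(2T g^{ii}\rho\big)\Big\}=\nabla\cdot\Big(\rho\,\big(\boldsymbol{G}(\boldsymbol{x})\big)^{-1}\nabla\zeta\Big),\qquad \zeta:=f+T\log\rho.$$ For $\rho\in\mathcal{P}_2(\mathcal{M})$ define the free energy functional $$F(\rho):=\mathbb{E}_{\rho}[\zeta]=\int_{\mathcal{M}}f\rho\,\mathrm{d}\boldsymbol{x}+T\int_{\mathcal{M}}\rho\log\rho\,\mathrm{d}\boldsymbol{x}.$$ Then the Fokker-Planck-Kolmogorov equation is a gradient flow of $F$ in $\mathcal{P}_2(\mathcal{M})$ with respect to the Wasserstein metric $W_{\boldsymbol{G}}$; that is, it can be transcribed into the form $$\frac{\partial\rho}{\partial t}=-\nabla^{W_{\boldsymbol{G}}}F(\rho).$$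
   Context: Here $\nabla$ and $\nabla\cdot$ are the Euclidean gradient and divergence in $\boldsymbol{x}$, and $\mathbb{E}_{\rho}[\cdot]=\int_{\mathcal{M}}(\cdot)\rho\,\mathrm{d}\boldsymbol{x}$. All probability measures are assumed absolutely continuous, and $\mathcal{P}_2(\mathcal{M})$ is the set of joint probability density functions supported on $\mathcal{M}$ with finite second raw moments. It is assumed that $g^{ii}=0$ at $x_i=0,1$; if the activation functions do not satisfy this, a reflecting boundary is imposed at each $x_i=0,1$ to keep the sample paths within the unit hypercube. The geodesic distance induced by $\boldsymbol{G}$ is $$d_{\boldsymbol{G}}(\boldsymbol{x},\boldsymbol{y}):=\int_0^1\Big(\sum_{i=1}^{n}g_{ii}(\gamma_i(t))\,\dot\gamma_i(t)^2\Big)^{1/2}\mathrm{d}t,$$ where $\boldsymbol{\gamma}$ is the (minimal) geodesic with $\boldsymbol{\gamma}(0)=\boldsymbol{x}$, $\boldsymbol{\gamma}(1)=\boldsymbol{y}$. The (quadratic) Wasserstein metric between probability measures $\mu,\nu$ on $\mathcal{M}$ is $$W_{\boldsymbol{G}}(\mu,\nu):=\Big(\inf_{\pi\in\Pi_2(\mu,\nu)}\int_{\mathcal{M}\times\mathcal{M}}d_{\boldsymbol{G}}(\boldsymbol{x},\boldsymbol{y})^2\,\mathrm{d}\pi(\boldsymbol{x},\boldsymbol{y})\Big)^{1/2},$$ where $\Pi_2(\mu,\nu)$ is the set of joint probability measures supported on $\mathcal{M}\times\mathcal{M}$ with finite second moment, $\boldsymbol{x}$-marginal $\mu$ and $\boldsymbol{y}$-marginal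 $\nu$. The Wasserstein gradient of a functional $\Phi$ at $\rho\in\mathcal{P}_2(\mathcal{M})$ is defined as $$\nabla^{W_{\boldsymbol{G}}}\Phi(\rho):=-\nabla\cdot\Big(\rho\,\big(\boldsymbol{G}(\boldsymbol{x})\big)^{-1}\nabla\frac{\delta\Phi}{\delta\rho}\Big),$$ where $\delta\Phi/\delta\rho$ denotes the functional derivative of $\Phi(\rho)$. *)

(* Defs.v *)
From HB Require Import structures.
From mathcomp Require Import all_boot all_order all_algebra.
From mathcomp Require Import all_classical all_reals all_analysis.

Set Implicit Arguments.
Unset Strict Implicit.
Unset Printing Implicit Defensive.

Import Order.TTheory GRing.Theory Num.Theory.
Import numFieldNormedType.Exports.

Local Open Scope classical_set_scope.
Local Open Scope ring_scope.

(* Product sigma-algebra on row vectors, mirroring the library's instance on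
   tuples. *)
Section row_vector_sigma_algebra.
Context {d : measure_display} {T : measurableType d} (n : nat).

Definition coordinate (i : 'I_n) (v : 'rV[T]_n) : T := v ord0 i.

Let rv_set0 : g_sigma_preimage coordinate set0.
Proof. exact: sigma_algebra0. Qed.

Let rv_setC A : g_sigma_preimage coordinate A ->
  g_sigma_preimage coordinate (~` A).
Proof. exact: sigma_algebraC. Qed.

Let rv_bigcup (F : _^nat) : (forall i, g_sigma_preimage coordinate (F i)) ->
  g_sigma_preimage coordinate (\bigcup_i (F i)).
Proof. exact: sigma_algebra_bigcup. Qed.

HB.instance Definition _ := @isMeasurable.Build (measure_tuple_display d)
  'rV[T]_n (g_sigma_preimage coordinate) rv_set0 rv_setC rv_bigcup.

Lemma measurable_coordinate (i : 'I_n) :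
  measurable_fun [set: 'rV[T]_n] (coordinate i).
Proof.
move=> _ Y mY; rewrite setTI; apply: sub_sigma_algebra => /=.
rewrite -bigcup_seq/=; exists i => /=; first by rewrite mem_index_enum.
by exists Y => //; rewrite setTI.
Qed.

Lemma measurable_row d' (S : measurableType d') (h : S -> 'rV[T]_n) :
  (forall i, measurable_fun setT (coordinate i \o h)) -> measurable_fun setT h.
Proof.
move=> mh _ A mA; rewrite setTI.
have : image_set_system setT h measurable A.
  apply: mA; split; first by apply: sigma_algebra_image; exact: sigma_algebra_measurable.
  rewrite -bigcup_seq => B [i _ [C mC <-]].
  rewrite /image_set_system /= !setTI.
  by have := mh i measurableT C mC; rewrite setTI.
by rewrite /image_set_system /= setTI.
Qed.

End row_vector_sigma_algebra.

(* Lebesgue measure on R^n, by iterating the product of the one-dimensional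
   Lebesgue measure with the measure already built on the last coordinates. *)
Section lebesgue_row_vector.
Variable R : realType.

Definition rV_cons n (p : (measurableTypeR R * 'rV[R]_n)%type) : 'rV[R]_n.+1 :=
  \row_i oapp (fun j => p.2 ord0 j) p.1 (unlift ord0 i).

Definition rV_uncons n (v : 'rV[R]_n.+1) :
    (measurableTypeR R * 'rV[R]_n)%type :=
  (v ord0 ord0, \row_j v ord0 (lift ord0 j)).

Lemma rV_consK n : cancel (@rV_cons n) (@rV_uncons n).
Proof.
move=> [a v]; rewrite /rV_uncons /rV_cons !mxE unlift_none; congr pair.
by apply/rowP => j; rewrite !mxE liftK.
Qed.

Lemma measurable_rV_cons n : measurable_fun setT (@rV_cons n).
Proof.
apply: measurable_row => i; have [j ij|i0] := unliftP ord0 i.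
  rewrite (_ : _ \o _ = coordinate j \o snd).
    by apply: measurableT_comp; [exact: measurable_coordinate|
                                 exact: measurable_snd].
  by apply/funext => p /=; rewrite /coordinate mxE ij liftK.
rewrite (_ : _ \o _ = fst); first exact: measurable_fst.
by apply/funext => p /=; rewrite /coordinate mxE i0 unlift_none.
Qed.

Lemma measurable_rV_uncons n : measurable_fun setT (@rV_uncons n).
Proof.
apply: measurable_fun_pair; first exact: measurable_coordinate.
apply: measurable_row => i.
rewrite (_ : _ \o _ = coordinate (lift ord0 i)).
  exact: measurable_coordinate.
by apply/funext => v; rewrite /coordinate /= mxE.
Qed.

Section step.
Variables (n : nat) (m : {sigma_finite_measure set 'rV[R]_n -> \bar R}).

Definition lebesgue_step : set 'rV[R]_n.+1 -> \bar R :=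
  pushforward (@lebesgue_measure R \x m)%E (@rV_cons n).

Let step0 : lebesgue_step set0 = 0%E.
Proof. by rewrite /lebesgue_step /pushforward preimage_set0 measure0. Qed.

Let step_ge0 A : (0 <= lebesgue_step A)%E.
Proof. by rewrite /lebesgue_step /pushforward; exact: measure_ge0. Qed.

Let step_sigma_additive : semi_sigma_additive lebesgue_step.
Proof.
move=> F mF tF mUF; rewrite /lebesgue_step /pushforward preimage_bigcup.
have mp A : measurable A -> measurable (@rV_cons n @^-1` A).
  by move=> mA; rewrite -[X in measurable X]setTI; exact: measurable_rV_cons.
apply: measure_semi_sigma_additive => [k||].
- exact: mp.
- apply/trivIsetP => /= i j _ _ ij; rewrite -preimage_setI.
  by move/trivIsetP : tF => /(_ i j) -> //; rewrite preimage_set0.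
- by rewrite -preimage_bigcup; exact: mp.
Qed.

HB.instance Definition _ := isMeasure.Build _ _ _ lebesgue_step
  step0 step_ge0 step_sigma_additive.

Let step_sigma_finite : sigma_finite setT lebesgue_step.
Proof.
have /sigma_finiteP[F [TF ndF Foo]] := sigma_finiteT (@lebesgue_measure R).
have /sigma_finiteP[G [TG ndG Goo]] := sigma_finiteT m.
exists (fun k => @rV_uncons n @^-1` (F k `*` G k)).
  rewrite -preimage_bigcup (_ : \bigcup_k (F k `*` G k) = setT).
    by rewrite preimage_setT.
  rewrite -setXTT TF TG predeqE => -[x y]; split.
    by move=> [k _ []/= ? ?]; split; exists k.
  move=> [/= [j _ Fjx] [k _ Gky]]; exists (maxn j k) => //; split.
  - by move: x Fjx; exact/subsetPset/ndF/leq_maxl.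
  - by move: y Gky; exact/subsetPset/ndG/leq_maxr.
move=> k; have [mF Fk] := Foo k; have [mG Gk] := Goo k; split.
  rewrite -[X in measurable X]setTI; apply: measurable_rV_uncons => //.
  exact: measurableX.
rewrite /lebesgue_step /pushforward -comp_preimage.
rewrite (_ : _ \o _ = id); last by rewrite funeqE; exact: rV_consK.
rewrite preimage_id product_measure1E//.
by rewrite lte_mul_pinfty// ge0_fin_numE.
Qed.

HB.instance Definition _ := Measure_isSigmaFinite.Build _ _ _ lebesgue_step
  step_sigma_finite.

End step.

Fixpoint lebesgue_rV (n : nat) :
    {sigma_finite_measure set 'rV[R]_n -> \bar R} :=
  match n with
  | 0 => \d_(0 : 'rV[R]_0)
  | m.+1 => lebesgue_step (lebesgue_rV m)
  end.

End lebesgue_row_vector.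

Section calculus.
Variables (R : realType) (n : nat).
Implicit Types (u : 'rV[R]_n -> R) (v : 'rV[R]_n -> 'cV[R]_n) (x : 'rV[R]_n).

Definition partial (i : 'I_n) u x : R := 'D_(delta_mx ord0 i) u x.

Definition grad u x : 'cV[R]_n := \col_i partial i u x.

Definition divergence v x : R := \sum_i partial i (fun y => v y i ord0) x.

Definition divergence_defined v x : Prop :=
  forall i, derivable (fun y => v y i ord0) x (delta_mx ord0 i).

Definition continuously_differentiable u : Prop :=
  (forall x, differentiable u x) /\ (forall i, continuous (partial i u)).

Definition unit_cube : set 'rV[R]_n := [set x | forall i, 0 < x ord0 i < 1].

Definition homeomorphism_onto (A : set 'rV[R]_n) (h : 'rV[R]_n -> 'rV[R]_n) :=
  [/\ set_bij setT A h, continuous h & {within A, continuous (pinv setT h)}].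

End calculus.

Section geometry.
Variables (R : realType) (n : nat) (sigma : 'I_n -> R -> R).

Definition activation (y : 'rV[R]_n) : 'rV[R]_n := \row_i sigma i (y ord0 i).

Definition activation_inv (i : 'I_n) : R -> R := pinv setT (sigma i).

(* [g_low i] is g_ii and [g_up i] is g^ii, as functions of the i-th
   coordinate. *)
Definition g_low (i : 'I_n) (s : R) : R :=
  1 / derive1 (sigma i) (activation_inv i s).

Definition g_up (i : 'I_n) (s : R) : R := 1 / g_low i s.

Definition metric_tensor (x : 'rV[R]_n) : 'M[R]_n :=
  diag_mx (\row_i g_low i (x ord0 i)).

(* [sigma] is only differentiable almost everywhere, whereas the coefficients
   of the equations below involve g_ii and the derivative of g^ii.  They are
   meaningful in a neighbourhood of [x] when, for [s] near each coordinate of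
   [x], the derivative of [sigma i] at the preimage of [s] exists and is
   nonzero (so that g_ii(s) is defined) and g^ii is differentiable at [s]. *)
Definition regular_point (x : 'rV[R]_n) : Prop :=
  forall i, \forall s \near x ord0 i,
    [/\ derivable (sigma i) (activation_inv i s) 1,
        derive1 (sigma i) (activation_inv i s) != 0 &
        derivable (g_up i) s 1].

End geometry.

Section densities.
Variables (R : realType) (n : nat).
Implicit Types (rho eta h : 'rV[R]_n -> R) (Phi : ('rV[R]_n -> R) -> R).

Local Notation mu := (lebesgue_rV R n).
Local Notation M := (@unit_cube R n).

(* P_2(M): densities are functions on R^n vanishing outside M. *)
Definition P2 rho : Prop :=
  [/\ measurable_fun setT rho,
      (forall x, 0 <= rho x),
      (forall x, ~ M x -> rho x = 0),
      (\int[mu]_(x in M) (rho x)%:E = 1)%E &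
      (\int[mu]_(x in M) ((\sum_i x ord0 i ^+ 2) * rho x)%:E < +oo)%E].

(* First variation of a functional on P_2(M), tested along the directions in
   which [rho] can be moved both ways inside P_2(M).  Such directions have
   zero mean, so [h] is determined up to an additive constant only; continuity
   on M makes its gradient independent of that constant and of the choice of
   a version of [h]. *)
Definition is_functional_derivative Phi rho h : Prop :=
  (forall x, M x -> {for x, continuous h}) /\
  (forall eta, (\forall e \near (0 : R), P2 (fun x => rho x + e * eta x)) ->
     mu.-integrable M (fun x => (h x * eta x)%:E) /\
     is_derive (0 : R) 1 (fun e : R => Phi (fun x => rho x + e * eta x))
       (\int[mu]_(x in M) (h x * eta x))).

(* One such [h], chosen arbitrarily when there is any. *)
Definition functional_derivative Phi rho : 'rV[R]_n -> R :=
  xget (fun=> 0) [set h | is_functional_derivative Phi rho h].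

Section wasserstein.
Variable G : 'rV[R]_n -> 'M[R]_n.

Definition metric_flux rho (u : 'rV[R]_n -> R) (x : 'rV[R]_n) : 'cV[R]_n :=
  rho x *: (invmx (G x) *m grad u x).

Definition wasserstein_gradient Phi rho (x : 'rV[R]_n) : R :=
  - divergence (metric_flux rho (functional_derivative Phi rho)) x.

End wasserstein.

Definition entropy_finite rho : Prop :=
  mu.-integrable M (fun x => (rho x * ln (rho x))%:E).

Definition zeta (T : R) (f : 'rV[R]_n -> R) rho (x : 'rV[R]_n) : R :=
  f x + T * ln (rho x).

Definition free_energy (T : R) (f : 'rV[R]_n -> R) rho : R :=
  \int[mu]_(x in M) (f x * rho x) + T * \int[mu]_(x in M) (rho x * ln (rho x)).

End densities.

Section diffusion_machine.
Variables (R : realType) (n : nat) (sigma : 'I_n -> R -> R).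
Variables (T : R) (f : 'rV[R]_n -> R).

Definition drift (x : 'rV[R]_n) (i : 'I_n) : R :=
  - g_up sigma i (x ord0 i) * partial i f x +
  T * derive1 (g_up sigma i) (x ord0 i).

Definition dispersion (x : 'rV[R]_n) (i : 'I_n) : R :=
  Num.sqrt (2 * T * g_up sigma i (x ord0 i)).

End diffusion_machine.

(* Minus the probability current of the Ito equation
     dx_i = b x i dt + s x i dw_i. *)
Definition fpk_flux (R : realType) (n : nat) (b s : 'rV[R]_n -> 'I_n -> R)
    (rho : 'rV[R]_n -> R) (x : 'rV[R]_n) : 'cV[R]_n :=
  \col_i (- (b x i * rho x) +
          1 / 2 * partial i (fun y => s y i ^+ 2 * rho y) x).

Section equations.
Variables (R : realType) (n : nat) (rho : R -> 'rV[R]_n -> R).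

(* d rho / dt = div J at time t and point x, in the classical sense. *)
Definition conservation_law (J : 'rV[R]_n -> 'cV[R]_n) (t : R) (x : 'rV[R]_n) :=
  [/\ derivable (rho ^~ x) t 1, divergence_defined J x &
      derive1 (rho ^~ x) t = divergence J x].

(* The Fokker-Planck-Kolmogorov equation of dx_i = b_i dt + s_i dw_i. *)
Definition fpk_equation (b s : 'rV[R]_n -> 'I_n -> R) (t : R) (x : 'rV[R]_n) :=
  conservation_law (fpk_flux b s (rho t)) t x.

(* d rho / dt = - grad^{W_G} Phi(rho), in the classical sense. *)
Definition gradient_flow_equation (G : 'rV[R]_n -> 'M[R]_n)
    (Phi : ('rV[R]_n -> R) -> R) (t : R) (x : 'rV[R]_n) :=
  [/\ derivable (rho ^~ x) t 1,
      divergence_defined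
        (metric_flux G (rho t) (functional_derivative Phi (rho t))) x &
      derive1 (rho ^~ x) t = - wasserstein_gradient G Phi (rho t) x].

End equations.

(* Main.v *)
Require Import Defs.
From mathcomp Require Import all_boot all_order all_algebra.
From mathcomp Require Import all_classical all_reals all_analysis.
From mathcomp Require Import measurable_realfun ring lra.

Set Implicit Arguments.
Unset Strict Implicit.
Unset Printing Implicit Defensive.

Import Order.TTheory GRing.Theory Num.Theory.
Import numFieldNormedType.Exports.

Local Open Scope classical_set_scope.
Local Open Scope ring_scope.

(** The Fokker-Planck equation and the gradient flow equation are conservation
    laws whose fluxes turn out to be the same.

    The first variation of the free energy at a positive density [r] of finite
    entropy is [zeta = f + T * ln r].  If [r + e * eta] is a density for all [e]
    near 0, then nonnegativity on both sides of 0 forces [|eta| <= r / e0] for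
    some [e0 > 0] ([direction_bound]).  Hence for small [e] the perturbed density
    lies between [r / 2] and [2 * r], and the derivative in [e] of the free energy
    density is dominated by a multiple of [r * (1 + |ln r|)], which is integrable.
    Differentiating under the integral ([is_derive_free_energy]) gives the
    integral of [(zeta + T) * eta], and the constant [T] drops out because [eta]
    has zero mean ([first_variation_zeta]).

    A functional derivative is only defined up to a constant, and the one that
    enters the Wasserstein gradient is chosen arbitrarily.  Any two of them,
    however, differ by a constant on the cube ([functional_derivative_unique]):
    the directions that move mass from a small box around one point to a small
    box around another are admissible, since [r] is continuous and positive, and
    they compare the values of a continuous function at the two points.  So the
    chosen one has the gradient of [zeta].

    Finally, at regular points the probability current of the stochastic equation
    equals the metric flux of [zeta] ([fpk_flux_zeta]): the derivative of
    [T * g_up * rho] contains [T * g_up' * rho], which cancels the correction term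
    in the drift, and [rho * grad (ln rho) = grad rho].  Each of the three
    equations says that [rho] has a time derivative equal to the divergence of a
    flux, and the three fluxes agree near the point considered, so the equations
    are equivalent ([conservation_law_near]). *)

(** * Directional derivatives and neighbourhoods of row vectors *)

Lemma deriveDcst (R : numFieldType) (V W : normedModType R) (u : V -> W)
    (c : W) (x v : V) : 'D_v (fun y => u y + c) x = 'D_v u x.
Proof.
rewrite /derive (_ : (fun h : R => _) =
  (fun h : R => h^-1 *: ((u \o shift x) (h *: v) - u x)))//.
by apply/funext => h; rewrite /= opprD addrACA subrr addr0.
Qed.

(** Both [b / a] and [a / b] are at most 2, and [ln c <= c - 1]. *)
Lemma ln_comparable (R : realType) (a b : R) : 0 < a -> a / 2 <= b -> b <= 2 * a ->
  `|ln b| <= `|ln a| + 1.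
Proof.
move=> a0 ab ba; have b0 : 0 < b by apply: lt_le_trans ab; rewrite divr_gt0.
have ln_le (c : R) : 0 < c -> c <= 2 -> ln c <= 1.
  move=> c0 c2; rewrite -[c](subrK 1) addrC.
  by rewrite (le_trans (le_ln1Dx _))//; lra.
have up : ln b - ln a <= 1.
  by rewrite -ln_div ?posrE// ln_le ?divr_gt0// ler_pdivrMr.
have lo : ln a - ln b <= 1.
  by rewrite -ln_div ?posrE// ln_le ?divr_gt0// ler_pdivrMr//; lra.
have := ler_norm (ln a); have := ler_norm (- ln a); rewrite normrN.
by move=> ? ?; rewrite ler_norml; apply/andP; split; lra.
Qed.

Section calculus_facts.
Variables (R : realType) (n : nat).
Implicit Types (x y v : 'rV[R]_n) (u : 'rV[R]_n -> R).

Lemma near_coordinates (P : 'I_n -> R -> Prop) x :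
  (forall i, \forall s \near x ord0 i, P i s) ->
  \forall y \near x, forall i, P i ((y : 'rV[R]_n) ord0 i).
Proof.
move=> xP.
apply: (@filter_forall _ _ (fun i => [set y : 'rV[R]_n | P i (y ord0 i)])
  (nbhs x) _) => i.
exact: (@coord_continuous R 1 n ord0 i x _ (xP i)).
Qed.

Lemma near_unit_cube x : unit_cube x -> \forall y \near x, unit_cube y.
Proof.
move=> Mx; apply: (@near_coordinates (fun _ s => 0 < s < 1)) => i.
have /andP[x0 x1] := Mx i; near=> s; apply/andP; split; near: s.
- exact: lt_nbhsr.
- exact: lt_nbhsl.
Unshelve. all: by end_near. Qed.

(** Directional chain rule for an outer function of one real variable: the
    inner differential is contracted with [v] before [phi] acts, so a derivative
    of [phi] at the single point [u x] is enough. *)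
Lemma is_derive_comp1 (phi : R -> R) u x v :
  derivable phi (u x) 1 -> differentiable u x ->
  is_derive x v (phi \o u) (derive1 phi (u x) * 'D_v u x).
Proof.
move=> /derivable1_diffP dphi du.
apply: DeriveDef; first exact/diff_derivable/differentiable_comp.
rewrite deriveE; last exact: differentiable_comp.
by rewrite diff_comp //= diff1E // deriveE // mulrC.
Qed.

Lemma is_derive_coord x (i : 'I_n) :
  is_derive x (delta_mx ord0 i) (fun y => y ord0 i) (1 : R).
Proof.
have q1 : (fun h : R => h^-1 *: ((h *: delta_mx ord0 i + x) ord0 i - x ord0 i))
    @ 0^' --> (1 : R).
  apply: cvg_near_cst; near=> h.
  have h0 : h != 0 by near: h; exact: nbhs_dnbhs_neq.
  by rewrite !mxE !eqxx mulr1 addrK /GRing.scale /= mulVf.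
by apply: DeriveDef; [apply/cvg_ex; exists 1 | apply: cvg_lim].
Unshelve. all: by end_near. Qed.

Lemma is_derive_coord_comp (phi : R -> R) x (i : 'I_n) :
  derivable phi (x ord0 i) 1 ->
  is_derive x (delta_mx ord0 i) (fun y => phi (y ord0 i))
    (derive1 phi (x ord0 i)).
Proof.
move=> dphi; have [_ e] := is_derive_coord x i.
have := @is_derive_comp1 phi (fun y => y ord0 i) x (delta_mx ord0 i) dphi
  (differentiable_coord _ _ _).
by rewrite e mulr1.
Qed.

Lemma is_derive_ln_comp u x v : 0 < u x -> differentiable u x ->
  is_derive x v (fun y => ln (u y)) ((u x)^-1 * 'D_v u x).
Proof.
move=> u0 du; have [dln eln] := is_derive1_ln u0.
by have := is_derive_comp1 v dln du; rewrite derive1E eln.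
Qed.

(** Both the existence and the value of a divergence at [x] are local, so fluxes
    that agree near [x] give the same equation there. *)
Lemma conservation_law_near (rho : R -> 'rV[R]_n -> R)
    (J K : 'rV[R]_n -> 'cV[R]_n) t x : {near x, J =1 K} ->
  conservation_law rho J t x <-> conservation_law rho K t x.
Proof.
have half (J' K' : 'rV[R]_n -> 'cV[R]_n) : {near x, J' =1 K'} ->
    conservation_law rho J' t x -> conservation_law rho K' t x.
  move=> JK [dr dJ e].
  have JKi i : {near x, (fun y => J' y i ord0) =1 (fun y => K' y i ord0)}.
    by near=> y; rewrite (near JK y).
  split => //; first by move=> i; exact: near_eq_derivable (JKi i) (dJ i).
  by rewrite e; apply: eq_bigr => i _; exact: near_eq_derive.
by move=> JK; split; apply: half => //; near=> y; rewrite (near JK y).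
Unshelve. all: by end_near. Qed.

Lemma gradient_flowE (rho : R -> 'rV[R]_n -> R) (G : 'rV[R]_n -> 'M[R]_n)
    (Phi : ('rV[R]_n -> R) -> R) t x :
  gradient_flow_equation rho G Phi t x <->
  conservation_law rho
    (metric_flux G (rho t) (functional_derivative Phi (rho t))) t x.
Proof.
by split=> -[dr dJ e]; split=> //; move: e; rewrite /wasserstein_gradient opprK.
Qed.

(** Every difference quotient of an increasing function is positive. *)
Lemma derive1_incr_ge0 (g : R -> R) a : (forall b c : R, b < c -> g b < g c) ->
  derivable g a 1 -> 0 <= derive1 g a.
Proof.
move=> g_incr dg; rewrite derive1E; apply: limr_ge; first exact: dg.
near=> h; have h0 : h != 0 by near: h; exact: nbhs_dnbhs_neq.
rewrite /GRing.scale /= mulr1.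
have [hn|hp|/eqP] := ltgtP h 0; last by rewrite (negbTE h0).
- rewrite nmulr_rge0 ?invr_lt0// subr_le0 ltW// g_incr//.
  by rewrite gtrDr.
- rewrite pmulr_rge0 ?invr_gt0// subr_ge0 ltW// g_incr//.
  by rewrite ltrDr.
Unshelve. all: by end_near. Qed.

Lemma invmx_diag_mul (d : 'rV[R]_n) (w : 'cV[R]_n) :
  (forall i, d ord0 i != 0) ->
  invmx (diag_mx d) *m w = \col_i ((d ord0 i)^-1 * w i ord0).
Proof.
move=> d0.
have dV : diag_mx d *m diag_mx (\row_i (d ord0 i)^-1) = 1%:M.
  rewrite mulmx_diag -diag_const_mx; congr diag_mx.
  by apply/rowP => i; rewrite !mxE mulfV.
have [du _] := mulmx1_unit dV.
rewrite (_ : invmx _ = diag_mx (\row_i (d ord0 i)^-1)); last first.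
  by rewrite -[RHS](mulKmx du) dV mulmx1.
by rewrite mul_diag_mx; apply/matrixP => i j; rewrite !mxE !ord1.
Qed.

End calculus_facts.

(** * The probability current as a metric flux *)

Section flux.
Variables (R : realType) (n : nat) (sigma : 'I_n -> R -> R).
Hypothesis sigma_incr : forall i (a b : R), a < b -> sigma i a < sigma i b.

(** Regularity asks for a property on a neighbourhood of each coordinate, hence
    it is an open condition. *)
Lemma near_regular_point x :
  regular_point sigma x -> \forall y \near x, regular_point sigma y.
Proof.
move=> reg; apply: (@near_coordinates _ _ (fun i s => \forall s' \near s,
  [/\ derivable (sigma i) (activation_inv sigma i s') 1,
        derive1 (sigma i) (activation_inv sigma i s') != 0 &
        derivable (g_up sigma i) s' 1])) => i.
exact/near_join/reg.
Qed.

Lemma g_upE i s : g_up sigma i s = derive1 (sigma i) (activation_inv sigma i s).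
Proof. by rewrite /g_up /g_low !div1r invrK. Qed.

(** Positivity makes the square of the dispersion coefficient equal to
    [2 * T * g_up], which is what turns the diffusion term into a derivative of
    [g_up]. *)
Lemma near_g_up_gt0 x i : regular_point sigma x ->
  \forall s \near x ord0 i, 0 < g_up sigma i s.
Proof.
move=> /(_ i); apply: filterS => s [ds s0 _].
by rewrite g_upE lt_def s0 derive1_incr_ge0//; exact: sigma_incr.
Qed.

Lemma regular_g_up_derivable x i : regular_point sigma x ->
  derivable (g_up sigma i) (x ord0 i) 1.
Proof. by move=> /(_ i) /nbhs_singleton []. Qed.

(** By the product rule the diffusion term is
    [T * g_up' * rho + T * g_up * d_i rho]; its first summand cancels the
    correction [T * g_up'] of the drift, and its second is
    [rho * g_up * d_i (T * ln rho)]. *)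
Lemma fpk_flux_zeta (T : R) (T_gt0 : 0 < T) (f rho : 'rV[R]_n -> R) x :
  regular_point sigma x -> differentiable f x ->
  differentiable rho x -> 0 < rho x ->
  fpk_flux (drift sigma T f) (dispersion sigma T) rho x =
  metric_flux (metric_tensor sigma) rho (zeta T f rho) x.
Proof.
move=> reg df drho rho0; rewrite /metric_flux /metric_tensor.
have g0 i : g_low sigma i (x ord0 i) != 0.
  have := nbhs_singleton (near_g_up_gt0 i reg).
  by rewrite /g_up div1r invr_gt0 => /lt0r_neq0.
rewrite invmx_diag_mul; last by move=> i; rewrite mxE.
apply/colP => i; rewrite !mxE -[(g_low _ _ _)^-1]div1r -/(g_up _ _ _).
pose e : 'rV[R]_n := delta_mx ord0 i.
have [_ dzeta] : is_derive x e (zeta T f rho)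
    (partial i f x + T * ((rho x)^-1 * partial i rho x)).
  have dl := is_derive_ln_comp e rho0 drho.
  apply: is_deriveD.
  by apply: DeriveDef => //; exact: diff_derivable.
rewrite /partial -/e dzeta.
have dg := is_derive_coord_comp (@regular_g_up_derivable x i reg).
have [_ dr] : is_derive x e
    (fun y => (2 * T) *: (g_up sigma i (y ord0 i) * rho y))
    ((2 * T) *: (g_up sigma i (x ord0 i) *: partial i rho x +
       rho x *: derive1 (g_up sigma i) (x ord0 i))).
  apply: is_deriveZ; apply: is_deriveM.
  by apply: DeriveDef => //; exact: diff_derivable.
rewrite (@near_eq_derive _ _ _ _
  (fun y : 'rV[R]_n => (2 * T) *: (g_up sigma i (y ord0 i) * rho y))); last first.
  (* The square root only cancels where [g_up] is nonnegative, and the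
     derivative needs this on a neighbourhood of [x]. *)
  have gpos := near_g_up_gt0 i reg.
  have : \forall y \near x, 0 < g_up sigma i ((y : 'rV[R]_n) ord0 i).
    exact: (@coord_continuous R 1 n ord0 i x _ gpos).
  apply: filterS => y gy; rewrite /dispersion sqr_sqrtr.
    by rewrite /GRing.scale /= !mulrA.
  by apply: mulr_ge0; [apply: mulr_ge0 => //|]; exact: ltW.
rewrite dr /drift /GRing.scale /= /partial.
by field; rewrite gt_eqF.
Qed.

End flux.

(** * Boxes, Lebesgue measure and continuous functions on row vectors *)

Section row_vector_measure.
Variable R : realType.

(** Open boxes do three jobs: the unit cube is one, the rational ones form a
    countable base of the topology, and their volumes are positive and finite. *)
Definition box n (a b : 'rV[R]_n) : set 'rV[R]_n :=
  [set x | forall i, a ord0 i < x ord0 i < b ord0 i].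

Lemma unit_cubeE n : @unit_cube R n = box 0 (const_mx 1).
Proof.
by apply/seteqP; split=> x xM i; have := xM i; rewrite !mxE.
Qed.

Lemma measurable_box n (a b : 'rV[R]_n) : measurable (box a b).
Proof.
rewrite (_ : box a b = \bigcap_(i in [set: 'I_n])
    (coordinate i @^-1` `]a ord0 i, b ord0 i[%classic)); last first.
  apply/seteqP; split=> x xab i; first by move=> _; rewrite /= in_itv /= xab.
  by have := xab i I; rewrite /= in_itv.
apply: fin_bigcap_measurable => // i _; rewrite -[X in measurable X]setTI.
exact: measurable_coordinate.
Qed.

Lemma measurable_unit_cube n : measurable (@unit_cube R n).
Proof. by rewrite unit_cubeE; exact: measurable_box. Qed.

(** Induction on the dimension: splitting off the first coordinate presents a box
    as an interval times a box, on which the product measure is multiplicative. *)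
Lemma lebesgue_box n (a b : 'rV[R]_n) : (forall i, a ord0 i < b ord0 i) ->
  (0 < lebesgue_rV R n (box a b) < +oo)%E.
Proof.
elim: n a b => [|n IH] a b ab.
  rewrite /= diracE mem_set; last by case.
  by rewrite lte01 ltry.
have /= := IH (\row_j a ord0 (lift ord0 j)) (\row_j b ord0 (lift ord0 j)).
set a' := \row_j _; set b' := \row_j _ => /(_ _)/andP[|m0 moo].
  by move=> i; rewrite !mxE.
rewrite /lebesgue_step /pushforward.
rewrite (_ : @rV_cons R n @^-1` _ = `]a ord0 ord0, b ord0 ord0[ `*` box a' b');
    last first.
  apply/seteqP; split=> -[s v] /=.
    move=> sv; split; first by have := sv ord0; rewrite mxE unlift_none in_itv.
    by move=> i; have := sv (lift ord0 i); rewrite !mxE liftK.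
  rewrite in_itv => -[/= s_ab v_ab] i; rewrite mxE.
  have [j ->|->] := unliftP ord0 i; last by [].
  by have := v_ab j; rewrite !mxE.
rewrite product_measure1E//; last exact: measurable_box.
have len : lebesgue_measure `]a ord0 ord0, b ord0 ord0[%classic =
    (b ord0 ord0 - a ord0 ord0)%:E.
  by rewrite lebesgue_measure_itv /= lte_fin ab -EFinD.
have ab0 : 0 < b ord0 ord0 - a ord0 ord0 by rewrite subr_gt0.
rewrite [X in (X * _)%E]len.
by rewrite mule_gt0 ?lte_fin//= lte_mul_pinfty// lee_fin ltW.
Qed.

Lemma box_sub_nbhs n (x : 'rV[R]_n) (U : set 'rV[R]_n) : nbhs x U ->
  exists2 e : R, 0 < e & box (x - const_mx e) (x + const_mx e) `<=` U.
Proof.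
move=> /nbhs_ballP[e /= e0 eU]; exists e => // y yx; apply: eU; split => // i j.
rewrite ord1 /ball /= ltr_norml; have := yx j; rewrite !mxE.
by move=> /andP[? ?]; apply/andP; split; lra.
Qed.

(** The sigma-algebra is generated by the coordinates, so openness has to be
    reduced to boxes: an open set is the union of the countably many boxes with
    rational corners that it contains. *)
Lemma open_measurable_rV n (U : set 'rV[R]_n) : open U -> measurable U.
Proof.
move=> oU.
pose B (q : 'rV[rat]_n * 'rV[rat]_n) : set 'rV[R]_n :=
  if pselect (box (map_mx ratr q.1) (map_mx ratr q.2) `<=` U) is left _
  then box (map_mx ratr q.1) (map_mx ratr q.2) else set0.
rewrite (_ : U = \bigcup_q B q).
  apply: countable_bigcupT_measurable => [|q]; first exact: countableP.
  rewrite /B.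
  by case: pselect => // _; exact: measurable_box.
apply/seteqP; split=> [x Ux|x [q _]]; last first.
  by rewrite /B; case: pselect => // qU; exact: qU.
have [e e0 eU] := box_sub_nbhs (open_nbhs_nbhs (conj oU Ux)).
have lo i : {q : rat | ratr q \in `]x ord0 i - e, x ord0 i[}.
  by apply/cid/rat_in_itvoo; lra.
have hi i : {q : rat | ratr q \in `]x ord0 i, x ord0 i + e[}.
  by apply/cid/rat_in_itvoo; lra.
exists (\row_i sval (lo i), \row_i sval (hi i)) => //=; rewrite /B /=.
case: pselect => [_ i|[]].
  rewrite !mxE; have := svalP (lo i); have := svalP (hi i); rewrite !in_itv /=.
  by move=> /andP[-> _] /andP[_ ->].
move=> y yx; apply: eU => i; have := yx i.
rewrite !mxE; have := svalP (lo i); have := svalP (hi i); rewrite !in_itv /=.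
by move=> /andP[? ?] /andP[? ?] /andP[? ?]; apply/andP; split; lra.
Qed.

Lemma continuous_measurable_rV n (f : 'rV[R]_n -> R) : continuous f ->
  measurable_fun setT f.
Proof.
move=> cf mT; apply: (measurability _ (RGenOInfty.measurableE R)) => //.
move=> /= _ [_ [a ->] <-]; rewrite setTI; apply: open_measurable_rV.
by move: cf => /continuousP; apply; exact: rray_open.
Qed.

(** The closed cube is compact; the margin 1 only serves to make the bound
    positive. *)
Lemma continuous_bounded_unit_cube n (f : 'rV[R]_n -> R) : continuous f ->
  exists2 C, 0 < C & forall x, unit_cube x -> `|f x| <= C.
Proof.
move=> cf.
have : compact (f @` [set x : 'rV[R]_n | forall i, `[0, 1]%classic (x ord0 i)]).
  apply: continuous_compact; first exact: continuous_subspaceT.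
  by apply: (@rV_compact R n (fun=> `[0, 1]%classic)) => i; exact: segment_compact.
move=> /compact_bounded [C [Creal CP]].
exists (Num.max C 0 + 1); first by rewrite ltr_pwDr// le_max lexx orbT.
move=> x Mx; apply: (CP (Num.max C 0 + 1)).
  by rewrite ltr_pwDr// le_max lexx.
exists x => // i /=; rewrite in_itv /=.
by have /andP[? ?] := Mx i; rewrite !ltW.
Qed.

End row_vector_measure.

(** * The first variation of the free energy *)

Section first_variation.
Variables (R : realType) (n : nat).
Local Notation mu := (lebesgue_rV R n).
Local Notation M := (@unit_cube R n).
Variable r : 'rV[R]_n -> R.
Hypothesis r_P2 : P2 r.
Hypothesis r_pos : forall x, M x -> 0 < r x.
Hypothesis r_ent : entropy_finite r.

Let mM : measurable M := @measurable_unit_cube R n.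

Let mr : measurable_fun setT r. Proof. by case: r_P2. Qed.

Lemma P2_integrable (s : 'rV[R]_n -> R) : P2 s -> mu.-integrable M (EFin \o s).
Proof.
move=> [ms s0 _ s1 _]; apply/integrableP; split.
  by apply/measurable_EFinP; exact: measurable_funTS.
under eq_integral do rewrite gee0_abs ?lee_fin//=.
by rewrite s1 ltry.
Qed.

Lemma P2_Rintegral (s : 'rV[R]_n -> R) : P2 s -> \int[mu]_(x in M) s x = 1.
Proof. by move=> [_ _ _ s1 _]; rewrite /Rintegral s1. Qed.

(** Integrable because [r] and [r * ln r] are.  It dominates, up to constants,
    the free energy densities along a perturbation of [r], their derivatives,
    and [zeta] times the direction. *)
Definition majorant (x : 'rV[R]_n) : R := r x * (1 + `|ln (r x)|).

Lemma majorant_ge0 x : 0 <= majorant x.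
Proof. by case: r_P2 => _ r0 _ _ _; rewrite mulr_ge0// addr_ge0. Qed.

Lemma le_majorant x : M x -> r x <= majorant x.
Proof.
by move=> Mx; rewrite /majorant mulrDr mulr1 lerDl mulr_ge0// ltW// r_pos.
Qed.

Lemma majorant_integrable k : mu.-integrable M (EFin \o (fun x => k * majorant x)).
Proof.
rewrite [X in mu.-integrable _ X](_ : _ = (fun x => k%:E * (majorant x)%:E)%E);
  last by [].
apply: integrableZl => //.
have -> : (fun x => (majorant x)%:E) =
    ((EFin \o r) \+ (fun x => `|(r x * ln (r x))%:E|))%E.
  apply/funext => x; rewrite /majorant /= -EFinD mulrDr mulr1 normrM.
  by rewrite (ger0_norm (_ : 0 <= r x))//; case: r_P2.
by apply: integrableD => //; [exact: P2_integrable|exact: integrable_abse].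
Qed.

Lemma majorant_dominated (g : 'rV[R]_n -> R) k : measurable_fun M g ->
  (forall x, M x -> `|g x| <= k * majorant x) -> mu.-integrable M (EFin \o g).
Proof.
move=> mg gk; apply: (le_integrable mM _ _ (majorant_integrable k)).
  exact/measurable_EFinP.
by move=> x Mx /=; rewrite lee_fin (le_trans (gk x Mx))// ler_norm.
Qed.

(** An admissible direction can be followed both ways, for all steps of size at
    most [e0]. *)
Section direction.
Variables (eta : 'rV[R]_n -> R) (e0 : R).
Hypothesis e0_gt0 : 0 < e0.
Hypothesis eta_P2 : forall e : R, `|e| <= e0 -> P2 (fun x => r x + e * eta x).

Let P2p : P2 (fun x => r x + e0 * eta x).
Proof. by apply: eta_P2; rewrite ger0_norm// ltW. Qed.

(** Nonnegativity of both [r + e0 * eta] and [r - e0 * eta].  This is what makes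
    every admissible direction integrable against [ln r] and keeps the perturbed
    densities comparable to [r]. *)
Lemma direction_bound x : `|eta x| <= r x / e0.
Proof.
have [_ /(_ x) p _ _ _] := P2p.
have [_ /(_ x) m _ _ _] : P2 (fun x => r x + - e0 * eta x).
  by apply: eta_P2; rewrite normrN ger0_norm// ltW.
by rewrite ler_pdivlMr// -[X in _ * X](gtr0_norm e0_gt0) -normrM ler_norml;
  apply/andP; split; lra.
Qed.

Lemma measurable_direction : measurable_fun setT eta.
Proof.
have -> : eta = (fun x => ((r x + e0 * eta x) - r x) * e0^-1).
  by apply/funext => x; field; rewrite gt_eqF.
apply: measurable_funM => //; apply: measurable_funB => //.
by case: P2p.
Qed.

Lemma direction_integrable : mu.-integrable M (EFin \o eta).
Proof.
apply: (@majorant_dominated _ e0^-1).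
  by apply: measurable_funTS; exact: measurable_direction.
move=> x Mx; rewrite (le_trans (direction_bound x))// /majorant mulrC.
by rewrite ler_pM2l ?invr_gt0// le_majorant.
Qed.

(** The total mass stays 1 along the perturbation. *)
Lemma direction_mean : \int[mu]_(x in M) eta x = 0.
Proof.
have := P2_Rintegral P2p; rewrite RintegralD//=; last first.
- exact: (integrableZl mM e0 direction_integrable).
- exact: P2_integrable.
rewrite (P2_Rintegral r_P2) RintegralZl//; last exact: direction_integrable.
move/eqP; rewrite -subr_eq0 addrAC subrr add0r mulf_eq0 gt_eqF//=.
by move/eqP.
Qed.

(** Half of the admissible range of steps keeps a definite fraction of [r], so
    the logarithm of the perturbed density stays within 1 of [ln r]. *)
Lemma perturbation_bounds e x : `|e| < e0 / 2 -> M x ->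
  r x / 2 <= r x + e * eta x <= 2 * r x.
Proof.
move=> ee Mx; have rx := r_pos Mx.
have : `|e * eta x| <= r x / 2.
  rewrite normrM; have := ler_pM (normr_ge0 e) (normr_ge0 _) (ltW ee)
    (direction_bound x).
  by rewrite (_ : e0 / 2 * (r x / e0) = r x / 2)//; field; rewrite gt_eqF.
by rewrite ler_norml => /andP[? ?]; apply/andP; split; lra.
Qed.

Lemma perturbation_gt0 e x : `|e| < e0 / 2 -> M x -> 0 < r x + e * eta x.
Proof.
move=> ee Mx; have /andP[+ _] := perturbation_bounds ee Mx.
by apply: lt_le_trans; rewrite divr_gt0// r_pos.
Qed.

Lemma perturbation_ln e x : `|e| < e0 / 2 -> M x ->
  `|ln (r x + e * eta x)| <= `|ln (r x)| + 1.
Proof.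
move=> ee Mx; have /andP[? ?] := perturbation_bounds ee Mx.
exact: (ln_comparable (r_pos Mx)).
Qed.

Let mpert e : measurable_fun setT (fun x => r x + e * eta x).
Proof.
by apply: measurable_funD => //; apply: measurable_funM => //;
  exact: measurable_direction.
Qed.

Lemma perturbation_entropy_integrable e : `|e| < e0 / 2 ->
  mu.-integrable M
    (EFin \o (fun x => (r x + e * eta x) * ln (r x + e * eta x))).
Proof.
move=> ee; apply: (@majorant_dominated _ 2).
  apply: measurable_funTS; apply: measurable_funM; first exact: mpert.
  by apply: measurableT_comp => //; exact: measurable_ln.
move=> x Mx; have /andP[_ up] := perturbation_bounds ee Mx.
rewrite normrM (gtr0_norm (perturbation_gt0 ee Mx)) /majorant mulrA.
apply: ler_pM => //; first exact/ltW/perturbation_gt0.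
by rewrite [1 + _]addrC perturbation_ln.
Qed.

Variables (T : R) (f : 'rV[R]_n -> R) (C : R).
Hypotheses (C_gt0 : 0 < C) (fC : forall x, M x -> `|f x| <= C).
Hypothesis mf : measurable_fun setT f.

Lemma perturbation_energy_integrable e : `|e| < e0 / 2 ->
  mu.-integrable M (EFin \o (fun x => f x * (r x + e * eta x))).
Proof.
move=> ee; apply: (@majorant_dominated _ (C * 2)).
  by apply: measurable_funTS; apply: measurable_funM => //; exact: mpert.
move=> x Mx; have /andP[_ up] := perturbation_bounds ee Mx.
rewrite normrM (gtr0_norm (perturbation_gt0 ee Mx)) -mulrA.
apply: ler_pM => //; [exact/ltW/perturbation_gt0|exact: fC|].
rewrite (le_trans up)//.
by rewrite ler_pM2l// le_majorant.
Qed.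

Definition energy_density e x : R :=
  f x * (r x + e * eta x) + T * ((r x + e * eta x) * ln (r x + e * eta x)).

Lemma free_energyE e : `|e| < e0 / 2 ->
  free_energy T f (fun x => r x + e * eta x) =
  \int[mu]_(x in M) energy_density e x.
Proof.
move=> ee; have Is := perturbation_entropy_integrable ee.
rewrite /free_energy /energy_density RintegralD//.
- by rewrite RintegralZl.
- exact: perturbation_energy_integrable.
- exact: (integrableZl mM T Is).
Qed.

Lemma energy_density_integrable e : `|e| < e0 / 2 ->
  mu.-integrable M (EFin \o energy_density e).
Proof.
move=> ee; exact: (integrableD mM (perturbation_energy_integrable ee)
  (integrableZl mM T (perturbation_entropy_integrable ee))).
Qed.

Lemma is_derive_energy_density (e : R) x : `|e| < e0 / 2 -> M x ->
  is_derive e 1 (energy_density ^~ x)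
    ((f x + T * (ln (r x + e * eta x) + 1)) * eta x).
Proof.
move=> ee Mx; have s0 := perturbation_gt0 ee Mx.
pose s (e' : R) := r x + e' * eta x.
have ds : is_derive e 1 s (eta x).
  have -> : s = cst (r x) + (eta x \*: id).
    by apply/funext => e'; rewrite /s mulrC.
  by apply: is_derive_eq; rewrite add0r /GRing.scale /= mulr1.
have dl := is_derive1_ln s0.
have dsl : is_derive e 1 (@ln R \o s) ((s e)^-1 * eta x).
  exact: is_derive1_comp.
have -> : energy_density ^~ x = (f x \*: s) + (T \*: (s * (@ln R \o s))).
  by [].
apply: is_derive_eq; rewrite /GRing.scale /= /s; field.
by rewrite gt_eqF.
Qed.

(** Differentiation under the integral sign, with a multiple of [majorant]
    dominating the derivatives of the densities uniformly in the step. *)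
Lemma is_derive_free_energy :
  is_derive (0 : R) 1 (fun e => free_energy T f (fun x => r x + e * eta x))
    (\int[mu]_(x in M) ((f x + T * (ln (r x) + 1)) * eta x)).
Proof.
pose I : set R := `]- (e0 / 2), e0 / 2[%classic.
have IP e : I e <-> `|e| < e0 / 2.
  by rewrite /I /= in_itv /= ltr_norml.
have e2 : 0 < e0 / 2 by rewrite divr_gt0.
have I0 : I 0 by apply/IP; rewrite normr0.
have intd e : I e -> mu.-integrable M (EFin \o energy_density e).
  by move=> /IP; exact: energy_density_integrable.
have dd e x : I e -> M x -> derivable (energy_density ^~ x) e 1.
  by move=> /IP ee Mx; have [] := is_derive_energy_density ee Mx.
have dE e x : I e -> M x -> partial1of2 energy_density e x =
    (f x + T * (ln (r x + e * eta x) + 1)) * eta x.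
  move=> /IP ee Mx; rewrite partial1of2E.
  by have [_ ->] := is_derive_energy_density ee Mx.
(* [C] bounds [f], and [ln s + 1] is at most [|ln r| + 2] in absolute value;
   the factor [1 / e0] comes from the bound on [eta]. *)
pose k := (C + `|T| * 2) / e0.
have k0 : 0 <= k by rewrite divr_ge0 ?addr_ge0 ?mulr_ge0 ?(ltW C_gt0) ?(ltW e0_gt0).
have G0 x : 0 <= k * majorant x by rewrite mulr_ge0// majorant_ge0.
have dG e x : I e -> M x -> `|partial1of2 energy_density e x| <= k * majorant x.
  move=> Ie Mx; rewrite dE//; move/IP: Ie => ee.
  have rx := r_pos Mx.
  have -> : k * majorant x =
      (C + `|T| * 2) * (1 + `|ln (r x)|) * (r x / e0).
    by rewrite /k /majorant; ring.
  rewrite normrM ler_pM// ?direction_bound//.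
  rewrite (le_trans (ler_normD _ _))// normrM mulrDl lerD//.
    by rewrite (le_trans (fC Mx))// mulrDr mulr1 lerDl mulr_ge0// ltW.
  rewrite -mulrA ler_wpM2l// (le_trans (ler_normD _ _))// normr1.
  have := perturbation_ln ee Mx; have := normr_ge0 (ln (r x)); lra.
have eF : {near (0 : R), (fun e => \int[mu]_(x in M) energy_density e x) =1
    (fun e => free_energy T f (fun x => r x + e * eta x))}.
  apply/nbhs_ballP; exists (e0 / 2) => //= e.
  by rewrite /ball /= sub0r normrN => /free_energyE ->.
have dF := derivable_under_integral mM I0 intd dd G0 (majorant_integrable k) dG.
apply: DeriveDef; first exact: near_eq_derivable eF dF.
rewrite -(near_eq_derive _ eF) -derive1E.
rewrite (differentiation_under_integral mM I0 intd dd G0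
  (majorant_integrable k) dG).
apply: eq_Rintegral => x /set_mem Mx.
by rewrite dE// mul0r addr0.
Qed.

Lemma zeta_direction_integrable :
  mu.-integrable M (EFin \o (fun x => zeta T f r x * eta x)).
Proof.
apply: (@majorant_dominated _ ((C + `|T|) / e0)).
  apply: measurable_funTS; apply: measurable_funM; last exact: measurable_direction.
  apply: measurable_funD => //; apply: measurable_funM => //.
  by apply: measurableT_comp => //; exact: measurable_ln.
move=> x Mx; have -> : (C + `|T|) / e0 * majorant x =
    (C + `|T|) * (1 + `|ln (r x)|) * (r x / e0).
  by rewrite /majorant; ring.
rewrite normrM ler_pM// ?direction_bound// /zeta.
rewrite (le_trans (ler_normD _ _))// normrM mulrDl lerD//.
  by rewrite (le_trans (fC Mx))// mulrDr mulr1 lerDl mulr_ge0// ltW.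
by rewrite ler_wpM2l// lerDr.
Qed.

(** The constant [T] produced by differentiating [s * ln s] is invisible to
    directions of zero mean. *)
Lemma first_variation_zeta :
  \int[mu]_(x in M) ((f x + T * (ln (r x) + 1)) * eta x) =
  \int[mu]_(x in M) (zeta T f r x * eta x).
Proof.
transitivity (\int[mu]_(x in M) (zeta T f r x * eta x + T * eta x)).
  by apply: eq_Rintegral => x _; rewrite /zeta; ring.
rewrite RintegralD//; first last.
- exact: (integrableZl mM T direction_integrable).
- exact: zeta_direction_integrable.
rewrite RintegralZl//; last exact: direction_integrable.
by rewrite direction_mean mulr0 addr0.
Qed.

End direction.

Lemma zeta_functional_derivative (T : R) (f : 'rV[R]_n -> R) : continuous f ->
  (forall x, M x -> differentiable r x) ->
  is_functional_derivative (free_energy T f) r (zeta T f r).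
Proof.
move=> cf dr; split=> [x Mx|eta].
  apply: (@continuousD _ _ _ f (fun y => T * ln (r y))); first exact: cf.
  apply: (@continuousM _ _ (cst T) (fun y => ln (r y))).
    exact: cst_continuous.
  apply: (@continuous_comp _ _ _ r (@ln R)).
    exact: differentiable_continuous (dr x Mx).
  exact: continuous_ln (r_pos Mx).
move=> /nbhs_ballP[d /= d0 dP].
have e0 : 0 < d / 2 by rewrite divr_gt0.
have eP e : `|e| <= d / 2 -> P2 (fun x => r x + e * eta x).
  by move=> ed; apply: dP; rewrite /ball /= sub0r normrN; lra.
have [C C0 fC] := continuous_bounded_unit_cube cf.
have mf := continuous_measurable_rV cf.
split; first exact: (zeta_direction_integrable e0 eP T C0 fC mf).
rewrite -(first_variation_zeta e0 eP T C0 fC mf).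
exact: (is_derive_free_energy e0 eP T C0 fC mf).
Qed.

End first_variation.

(** * Uniqueness of functional derivatives up to a constant *)

Section uniqueness.
Variables (R : realType) (n : nat).
Local Notation mu := (lebesgue_rV R n).
Local Notation M := (@unit_cube R n).

Let mM : measurable M := @measurable_unit_cube R n.

Lemma box_in_nbhs (x : 'rV[R]_n) (U : set 'rV[R]_n) : nbhs x U ->
  exists A, [/\ measurable A, A `<=` U & (0 < mu A < +oo)%E].
Proof.
move=> /box_sub_nbhs[e e0 eU].
exists (box (x - const_mx e) (x + const_mx e)); split => //.
  exact: measurable_box.
by apply: lebesgue_box => i; rewrite !mxE; lra.
Qed.

Definition uniform_density (A : set 'rV[R]_n) (x : 'rV[R]_n) : R :=
  (fine (mu A))^-1 * \1_A x.

Section uniform.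
Variable A : set 'rV[R]_n.
Hypotheses (mA : measurable A) (AM : A `<=` M) (A_gt0 : (0 < mu A < +oo)%E).

Lemma fine_mu_gt0 : 0 < fine (mu A).
Proof. exact: fine_gt0. Qed.

Lemma measurable_uniform_density : measurable_fun setT (uniform_density A).
Proof. by apply: measurable_funM => //; exact: measurable_indic. Qed.

Lemma indic_integrable : mu.-integrable M (EFin \o \1_A).
Proof.
apply/integrableP; split.
  by apply/measurable_EFinP/measurable_indic.
under eq_integral do rewrite /= ger0_norm//.
rewrite integral_indic// (setIidl AM).
by case/andP: A_gt0.
Qed.

Lemma uniform_density_integrable : mu.-integrable M (EFin \o uniform_density A).
Proof. exact: (integrableZl mM _ indic_integrable). Qed.

Lemma uniform_density_mass : \int[mu]_(x in M) uniform_density A x = 1.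
Proof.
rewrite RintegralZl//; last exact: indic_integrable.
rewrite /Rintegral integral_indic// (setIidl AM) mulVf//.
by rewrite gt_eqF// fine_mu_gt0.
Qed.

Lemma uniform_density_bounds x : 0 <= uniform_density A x <= (fine (mu A))^-1.
Proof.
have := fine_mu_gt0; rewrite -invr_gt0 => v0; rewrite /uniform_density indicE.
by case: (_ \in _); rewrite ?mulr1 ?mulr0 ?lexx ltW.
Qed.

End uniform.

(** On the unit cube the squared norm is at most [n]. *)
Lemma second_moment_lty (s : 'rV[R]_n -> R) : measurable_fun setT s ->
  mu.-integrable M (EFin \o s) -> (forall x, 0 <= s x) ->
  (\int[mu]_(x in M) ((\sum_i x ord0 i ^+ 2) * s x)%:E < +oo)%E.
Proof.
move=> ms Is s0.
have sq0 (x : 'rV[R]_n) : 0 <= \sum_i x ord0 i ^+ 2.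
  by apply: sumr_ge0 => i _; exact: sqr_ge0.
have : mu.-integrable M (EFin \o (fun x : 'rV[R]_n => (\sum_i x ord0 i ^+ 2) * s x)).
  apply: (le_integrable mM _ _ (integrableZl mM n%:R Is)).
    apply/measurable_EFinP; apply: measurable_funTS; apply: measurable_funM => //.
    apply: measurable_sum => i; apply: measurable_funX.
    exact: (@measurable_coordinate _ R n i).
  move=> x Mx /=; rewrite lee_fin !normrM ler_wpM2r// ger0_norm//.
  rewrite normr_nat -[n in leRHS]card_ord -sumr_const ler_sum// => i _.
  by have /andP[? ?] := Mx i; rewrite expr_le1// ltW.
case/integrableP => _; under eq_integral => x _.
  rewrite /= ger0_norm ?mulr_ge0//; over.
by [].
Qed.

(** Moving a little mass from [A] to [B] is an admissible direction as soon as
    the density is bounded below by a positive constant on both sets. *)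
Section bump_direction.
Variable r : 'rV[R]_n -> R.
Hypothesis r_P2 : P2 r.
Variables (A B : set 'rV[R]_n) (c : R).
Hypotheses (mA : measurable A) (AM : A `<=` M) (A_gt0 : (0 < mu A < +oo)%E).
Hypotheses (mB : measurable B) (BM : B `<=` M) (B_gt0 : (0 < mu B < +oo)%E).
Hypotheses (c_gt0 : 0 < c) (rA : forall x, A x -> c <= r x)
  (rB : forall x, B x -> c <= r x).

Definition bump (x : 'rV[R]_n) : R := uniform_density B x - uniform_density A x.

Lemma bump_integrable : mu.-integrable M (EFin \o bump).
Proof.
exact: (integrableB mM (uniform_density_integrable mB BM B_gt0)
  (uniform_density_integrable mA AM A_gt0)).
Qed.

Lemma bump_mean : \int[mu]_(x in M) bump x = 0.
Proof.
rewrite RintegralB//; try exact: uniform_density_integrable.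
by rewrite !uniform_density_mass// subrr.
Qed.

Lemma bump_admissible : \forall e \near (0 : R), P2 (fun x => r x + e * bump x).
Proof.
(* [K] bounds the direction, so a step below [c / K] removes at most [c]. *)
pose K := (fine (mu A))^-1 + (fine (mu B))^-1.
have K0 : 0 < K by rewrite addr_gt0// invr_gt0 fine_mu_gt0.
have bumpK x : `|bump x| <= K.
  rewrite ler_norml /bump /K; have := uniform_density_bounds A_gt0 x.
  have := uniform_density_bounds B_gt0 x.
  by move=> /andP[? ?] /andP[? ?]; apply/andP; split; lra.
have [mr r0 rM r1 r2] := r_P2.
have bump0 x : ~ A x -> ~ B x -> bump x = 0.
  move=> Ax Bx; rewrite /bump /uniform_density !indicE.
  by rewrite !memNset// !mulr0 subrr.
apply/nbhs_ballP; exists (c / K); first exact: divr_gt0.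
move=> e; rewrite /ball /= sub0r normrN => eK.
have ebump x : `|e * bump x| <= c.
  rewrite normrM (le_trans (ler_pM _ _ (ltW eK) (bumpK x)))//.
  by rewrite divfK// gt_eqF.
have pos x : 0 <= r x + e * bump x.
  have cpos : c <= r x -> 0 <= r x + e * bump x.
    by move=> ?; have := ebump x; rewrite ler_norml => /andP[? _]; lra.
  have [Ax|nAx] := pselect (A x); first exact/cpos/rA.
  have [Bx|nBx] := pselect (B x); first exact/cpos/rB.
  by rewrite bump0// mulr0 addr0.
have mp : measurable_fun setT (fun x => r x + e * bump x).
  apply: measurable_funD => //; apply: measurable_funM => //.
  by apply: measurable_funB; exact: measurable_uniform_density.
have Ip : mu.-integrable M (EFin \o (fun x => r x + e * bump x)).
  exact: (integrableD mM (P2_integrable r_P2) (integrableZl mM e bump_integrable)).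
split => //.
- move=> x Mx; rewrite rM// bump0 ?mulr0 ?addr0//; first by move=> /AM.
  by move=> /BM.
- have : \int[mu]_(x in M) (r x + e * bump x) = 1.
    rewrite RintegralD//; [|exact: P2_integrable|
      exact: (integrableZl mM e bump_integrable)].
    rewrite RintegralZl//; last exact: bump_integrable.
    by rewrite bump_mean mulr0 addr0 P2_Rintegral.
  rewrite /Rintegral => p1; rewrite -[LHS]fineK ?p1//.
  exact: integrable_fin_num.
- exact: second_moment_lty.
Qed.

End bump_direction.

(** If the difference [k] of the two candidates were larger at [b] than at [a],
    then moving mass from a small box around [a] to one around [b] would be an
    admissible direction along which [k] has a positive integral, whereas both
    candidates integrate to the same derivative of [Phi]. *)
Lemma functional_derivative_unique (Phi : ('rV[R]_n -> R) -> R)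
    (r h1 h2 : 'rV[R]_n -> R) : P2 r ->
  (forall x, M x -> 0 < r x) -> (forall x, M x -> {for x, continuous r}) ->
  is_functional_derivative Phi r h1 -> is_functional_derivative Phi r h2 ->
  forall a b, M a -> M b -> h1 a - h2 a = h1 b - h2 b.
Proof.
move=> r_P2 r_pos cr [ch1 dh1] [ch2 dh2].
pose k x := h1 x - h2 x.
suff le_k a b : M a -> M b -> k b <= k a.
  by move=> a b Ma Mb; apply/eqP; rewrite eq_le !le_k.
move=> Ma Mb; rewrite leNgt; apply/negP => kab.
have ck x : M x -> {for x, continuous k}.
  by move=> Mx; apply: (@continuousB _ _ _ h1 h2); [exact: ch1|exact: ch2].
(* On the boxes [k] is within [d] of its values at the centres; a third of the
   gap leaves a surplus of [k b - k a - 2 * d = d > 0] in the integral. *)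
pose d := (k b - k a) / 3.
have d0 : 0 < d by rewrite divr_gt0// subr_gt0.
pose c := Num.min (r a) (r b) / 2.
have rab0 : 0 < Num.min (r a) (r b) by rewrite lt_min !r_pos.
have c0 : 0 < c by rewrite divr_gt0.
have c_lt : c < Num.min (r a) (r b) by rewrite /c; lra.
have good x : M x -> c < r x -> \forall y \near x,
    [/\ M y, c <= r y & `|k x - k y| < d].
  move=> Mx cx; have cM := near_unit_cube Mx.
  have cR : \forall y \near x, c < r y by exact: (cr x Mx _ (lt_nbhsr cx)).
  have cK : \forall y \near x, `|k x - k y| < d.
    by move: (ck x Mx) => /cvgrPdist_lt; exact.
  by near=> y; split; [|apply/ltW|]; near: y.
have [A [mA AU A0]] : exists A, [/\ measurable A,
    A `<=` [set y | [/\ M y, c <= r y & `|k a - k y| < d]] &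
    (0 < mu A < +oo)%E].
  by apply: box_in_nbhs; apply: good => //; move: c_lt; rewrite lt_min => /andP[].
have [B [mB BU B0]] : exists B, [/\ measurable B,
    B `<=` [set y | [/\ M y, c <= r y & `|k b - k y| < d]] &
    (0 < mu B < +oo)%E].
  by apply: box_in_nbhs; apply: good => //; move: c_lt; rewrite lt_min => /andP[].
have AM : A `<=` M by move=> y /AU[].
have BM : B `<=` M by move=> y /BU[].
have rA y : A y -> c <= r y by move=> /AU[].
have rB y : B y -> c <= r y by move=> /BU[].
have adm := bump_admissible r_P2 mA AM A0 mB BM B0 c0 rA rB.
have [I1 [_ D1]] := dh1 _ adm; have [I2 [_ D2]] := dh2 _ adm.
have k0 : \int[mu]_(x in M) (k x * bump A B x) = 0.
  transitivity (\int[mu]_(x in M) (h1 x * bump A B x - h2 x * bump A B x)).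
    by apply: eq_Rintegral => x _; rewrite /k mulrBl.
  by rewrite RintegralB// -D1 -D2 subrr.
have IA := uniform_density_integrable mA AM A0.
have IB := uniform_density_integrable mB BM B0.
have : \int[mu]_(x in M) ((k b - d) * uniform_density B x -
      (k a + d) * uniform_density A x) <= \int[mu]_(x in M) (k x * bump A B x).
  apply: le_Rintegral => //.
  - exact: (integrableB mM (integrableZl mM (k b - d) IB)
      (integrableZl mM (k a + d) IA)).
  - have := integrableB mM I1 I2; apply: eq_integrable => // x _ /=.
    by rewrite /k mulrBl EFinB.
  - move=> x Mx; rewrite /bump mulrBr lerB//.
      have [Bx|nBx] := pselect (B x); last first.
        by rewrite /uniform_density indicE memNset// !mulr0.
      rewrite ler_wpM2r//; first by case/andP: (uniform_density_bounds B0 x).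
      by have [_ _] := BU _ Bx; rewrite ltr_norml => /andP[? ?]; lra.
    have [Ax|nAx] := pselect (A x); last first.
      by rewrite /uniform_density indicE memNset// !mulr0.
    rewrite ler_wpM2r//; first by case/andP: (uniform_density_bounds A0 x).
    by have [_ _] := AU _ Ax; rewrite ltr_norml => /andP[? ?]; lra.
rewrite k0 RintegralB//; first last.
- exact: (integrableZl mM (k a + d) IA).
- exact: (integrableZl mM (k b - d) IB).
rewrite (RintegralZl _ mM IB) (RintegralZl _ mM IA).
rewrite !uniform_density_mass// !mulr1.
have : k b - k a = 3 * d by rewrite /d; field.
by lra.
Unshelve. all: by end_near. Qed.

End uniqueness.

(** * The gradient flow *)

Theorem mainTheorem2 (R : realType) (n : nat) (n_gt0 : (0 < n)%N)
    (T : R) (T_gt0 : 0 < T)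
    (f : 'rV[R]_n -> R) (f_C1 : continuously_differentiable f)
    (sigma : 'I_n -> R -> R)
    (sigma_incr : forall i (a b : R), a < b -> sigma i a < sigma i b)
    (sigma_homeo :
      homeomorphism_onto (@unit_cube R n) (activation sigma))
    (sigma_diff :
      {ae lebesgue_rV R n, forall y, differentiable (activation sigma) y})
    (rho0 : 'rV[R]_n -> R) (rho0_P2 : P2 rho0)
    (rho : R -> 'rV[R]_n -> R) (rho_init : rho 0 = rho0)
    (rho_P2 : forall t, 0 < t -> P2 (rho t))
    (rho_pos : forall t x, 0 < t -> unit_cube x -> 0 < rho t x)
    (rho_diff : forall t x, 0 < t -> unit_cube x -> differentiable (rho t) x)
    (rho_ent : forall t, 0 < t -> entropy_finite (rho t)) :
  let G := metric_tensor sigma in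
  let F := free_energy T f in
  (forall t, 0 < t ->
     is_functional_derivative F (rho t) (functional_derivative F (rho t))) /\
  (forall t x, 0 < t -> unit_cube x -> regular_point sigma x ->
     (fpk_equation rho (drift sigma T f) (dispersion sigma T) t x <->
      conservation_law rho (metric_flux G (rho t) (zeta T f (rho t))) t x) /\
     (fpk_equation rho (drift sigma T f) (dispersion sigma T) t x <->
      gradient_flow_equation rho G F t x)).
Proof.
move=> G F.
have fC : continuous f.
  by move=> x; apply: differentiable_continuous; case: f_C1.
have zetaP t : 0 < t ->
    is_functional_derivative F (rho t) (zeta T f (rho t)).
  move=> t0; apply: zeta_functional_derivative => //.
  - exact: rho_P2.
  - by move=> x; exact: rho_pos.
  - exact: rho_ent.
  - by move=> x; exact: rho_diff.
have fdP t : 0 < t ->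
    is_functional_derivative F (rho t) (functional_derivative F (rho t)).
  by move=> t0; apply: xgetPex; exists (zeta T f (rho t)); exact: zetaP.
split=> // t x t0 Mx reg.
have fpk_zeta : fpk_equation rho (drift sigma T f) (dispersion sigma T) t x <->
    conservation_law rho (metric_flux G (rho t) (zeta T f (rho t))) t x.
  apply: conservation_law_near.
  have MU := near_unit_cube Mx; have regU := near_regular_point reg.
  near=> y; have My : unit_cube y by near: y.
  apply: fpk_flux_zeta => //; first by near: y.
  - by case: f_C1.
  - exact: rho_diff.
  - exact: rho_pos.
split=> //; apply: (iff_trans fpk_zeta).
apply: iff_trans (iff_sym (gradient_flowE _ _ _ _ _)).
apply: conservation_law_near.
(* The gradients at [y] depend on the values around [y], which must lie in the
   cube as well. *)
have MU := near_join (near_unit_cube Mx).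
near=> y; have MyU : \forall z \near y, unit_cube z by near: y.
have My := nbhs_singleton MyU.
rewrite /metric_flux; congr (_ *: (_ *m _)); apply/colP => i; rewrite !mxE.
set h := functional_derivative F (rho t).
(* Shifting [h] by the constant that makes it agree with [zeta] at [y] makes the
   two functions agree on a neighbourhood of [y]. *)
rewrite /partial -(deriveDcst h (zeta T f (rho t) y - h y)).
apply: near_eq_derive; near=> z; have Mz : unit_cube z by near: z.
have := functional_derivative_unique (rho_P2 t t0)
  (fun x => rho_pos t x t0)
  (fun x Mx => differentiable_continuous (rho_diff t x t0 Mx))
  (zetaP t t0) (fdP t t0) My Mz.
by rewrite -/h; lra.
Unshelve. all: by end_near. Qed.
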